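(* Let $(X,d)$ be a complete regular semimetric space with an upper semicontinuous triangle function $\Phi\colon\mathbb{R}_+^2\to\mathbb{R}_+$ for $d$, let $\varphi:\mathbb{R}_+\to\mathbb{R}_+$ be an upper semicontinuous comparison function, and let $T_1,\ldots,T_n\colon X\to X$ be $\varphi$-contractions. Define $T:\mathscr{K}(X)\to\mathscr{K}(X)$ by $T(H)=\bigcup_{k=1}^nT_k(H)$. Let $H\in\mathscr{K}(X)$ and let $H_0$ be the unique fractal in $\mathscr{K}(X)$ with respect to the system $(T_1,\ldots,T_n)$. Define the sequence $(H_k)_{k\ge1}$ recursively by $H_1:=H$, $H_{k+1}:=T(H_k)$, and define $\psi:\mathbb{R}_+\to[0,\infty]$ by $$\psi(t):=\sup\{s\geq0\mid s\leq \Phi(t,\varphi(s))\}\qquad(t\in\mathbb{R}_+).$$ Then, for all $k\in\mathbb{N}=\{1,2,\dots\}$ and all $\ell\in\{1,\dots,k\}$, $$D(H_k,H_0)\le\psi\bigl(\varphi^{k-\ell}(D(H_\ell,H_{\ell+1}))\bigr),$$ and, for all $k\ge2$, $$D(H_k,H_0)\le\varphi(D(H_{k-1},H_0)).$$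
   Context: $\mathbb{R}_+=[0,\infty)$. A semimetric space $(X,d)$ is a nonempty set $X$ with a symmetric function $d:X\times X\to\mathbb{R}_+$ such that $d(x,y)=0$ if and only if $x=y$ (no triangle inequality is assumed). A triangle function for $d$ is a symmetric function $\Phi:\mathbb{R}_+^2\to[0,\infty]$, monotone increasing (in the weak sense) in both arguments, with $\Phi(0,0)=0$ and $d(x,y)\le\Phi(d(x,z),d(z,y))$ for all $x,y,z\in X$; here $\Phi$ is assumed to be finite-valued. The space is regular if it admits some triangle function that is continuous at $(0,0)$. A sequence $(x_n)$ converges to $x$ if $d(x_n,x)\to0$; it is Cauchy if for every $\varepsilon>0$ there is $n_0$ with $d(x_n,x_m)<\varepsilon$ for $n,m\ge n_0$; the space is complete if every Cauchy sequence converges. For $p\in X$ and $r\in(0,\infty]$, the ball is $\mathscr{B}(p,r)=\{x\in X: d(x,p)<r\}$. A set $A\subseteq X$ is open if for every $p\in A$ there is $r>0$ with $\mathscr{B}(p,r)\subseteq A$; the open sets form a topology on $X$ (balls need not be open). A set is compact if each of its covers by open sets has a finite subcover; $\mathscr{K}(X)$ is the family of all nonempty compact subsets of $X$. For nonempty $A,B\subseteq X$ the Hausdorff--Pompeiu distance is $$D(A,B)=\inf\Bigl\{\varepsilon\in(0,\infty]\ \Big|\ A\subseteq\bigcup_{b\in B}\mathscr{B}(b,\varepsilon),\ B\subseteq\bigcup_{a\in A}\mathscr{B}(a,\varepsilon)\Bigr\}.$$ A comparison function is a map $\varphi:\mathbb{R}_+\to\mathbb{R}_+$ that is increasing ($s\le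 t$ implies $\varphi(s)\le\varphi(t)$) and satisfies $\lim_{m\to\infty}\varphi^m(t)=0$ for all $t>0$, where $\varphi^m$ is the $m$-th iterate ($\varphi^0$ is the identity). A map $S:X\to X$ is a $\varphi$-contraction if $d(S(x),S(y))\le\varphi(d(x,y))$ for all $x,y\in X$. A fractal with respect to $(T_1,\dots,T_n)$ is a nonempty set $F\subseteq X$ with $F=\bigcup_{k=1}^nT_k(F)$; under the hypotheses there is exactly one fractal in $\mathscr{K}(X)$. The symbol $H_0$ denotes this fractal and is not a term of the iteration, which starts at $H_1$. *)

(* Defs.v *)
From HB Require Import structures.
From mathcomp Require Import all_boot all_order all_algebra.
From mathcomp Require Import all_classical all_reals all_analysis.

Set Implicit Arguments.
Unset Strict Implicit.
Unset Printing Implicit Defensive.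

Import Order.TTheory GRing.Theory Num.Theory.
Import numFieldNormedType.Exports.

Local Open Scope classical_set_scope.
Local Open Scope ring_scope.

(* The half line [0, +oo[ is {nonneg R}, with the topology induced by R. *)
HB.instance Definition _ (R : realType) (i : Itv.t) :=
  Topological.copy (Itv.def (@Itv.num_sem R) i)
    (initial_topology (fun x : Itv.def (@Itv.num_sem R) i => x%:num)).

(* Mirror image of the library's lower_semicontinuous. *)
Definition upper_semicontinuous (R : realType) (T : topologicalType)
    (f : T -> \bar R) :=
  forall x a, (f x < a%:E)%E ->
    exists2 V, nbhs x V & forall y, V y -> (f y < a%:E)%E.

Record semimetric (R : realType) (X : Type) := Semimetric {
  sdist :> X -> X -> {nonneg R};
  sdistC : forall x y, sdist x y = sdist y x;
  sdist_eq0 : forall x y, sdist x y = 0%:nng <-> x = y }.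

Section semimetric_spaces.
Context {R : realType} {X : pointedType}.
Implicit Types (d : semimetric R X) (A B : set X).

Definition sball d (p : X) (r : \bar R) : set X :=
  [set x | ((d x p)%:num%:E < r)%E].

Definition sopen d A :=
  forall p, A p -> exists2 r : \bar R, (0 < r)%E & sball d p r `<=` A.

(* X with the topology of the open sets of d; balls need not be open. *)
Definition semimetric_topology d : Type := X.

Section topology.
Variable d : semimetric R X.

HB.instance Definition _ := Pointed.on (semimetric_topology d).

Let sopenT : sopen d setT.
Proof. by move=> p _; exists 1%E; rewrite ?lte01. Qed.

Let sopenI A B : sopen d A -> sopen d B -> sopen d (A `&` B).
Proof.
move=> oA oB p [/oA[r r0 rA] /oB[s s0 sB]].
exists (Order.min r s); first by rewrite lt_min r0 s0.
by move=> x; rewrite /sball/= lt_min => /andP[? ?]; split; [exact: rA|exact: sB].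
Qed.

Let sopen_bigU (I : Type) (f : I -> set X) :
  (forall i, sopen d (f i)) -> sopen d (\bigcup_i f i).
Proof.
move=> of_ p [i _ /of_[r r0 rf]]; exists r => // x /rf fx.
by exists i.
Qed.

HB.instance Definition _ :=
  isOpenTopological.Build (semimetric_topology d) sopenT sopenI sopen_bigU.

End topology.

Definition compact_nonempty d A :=
  A !=set0 /\ cover_compact (A : set (semimetric_topology d)).

Definition triangle_function d (Phi : {nonneg R} -> {nonneg R} -> \bar R) :=
  [/\ forall u v, (0 <= Phi u v)%E,
      forall u v, Phi u v = Phi v u,
      forall u u' v v', u <= u' -> v <= v' -> (Phi u v <= Phi u' v')%E,
      Phi 0%:nng 0%:nng = 0%E &
      forall x y z, ((d x y)%:num%:E <= Phi (d x z) (d z y))%E].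

Definition regular_semimetric d :=
  exists2 Phi, triangle_function d Phi &
    {for (0%:nng, 0%:nng),
      continuous (fun uv : {nonneg R} * {nonneg R} => Phi uv.1 uv.2)}.

Definition scvg d (u : nat -> X) (x : X) :=
  (d (u n) x)%:num @[n --> \oo] --> (0 : R).

Definition scauchy d (u : nat -> X) :=
  forall e : R, 0 < e ->
    exists n0 : nat, forall n m, (n0 <= n)%N -> (n0 <= m)%N ->
      (d (u n) (u m))%:num < e.

Definition scomplete d := forall u, scauchy d u -> exists x, scvg d u x.

(* The radius +oo is allowed, so that the infimum is over a nonempty set. *)
Definition hausdorff_pompeiu d A B : \bar R :=
  ereal_inf [set e : \bar R | [/\ (0 < e)%E,
    A `<=` \bigcup_(b in B) sball d b e &
    B `<=` \bigcup_(a in A) sball d a e]].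

Definition phi_contraction d (phi : {nonneg R} -> {nonneg R}) (S : X -> X) :=
  forall x y, d (S x) (S y) <= phi (d x y).

End semimetric_spaces.

Definition comparison_function (R : realType)
    (phi : {nonneg R} -> {nonneg R}) :=
  {homo phi : s t / s <= t} /\
  forall t : {nonneg R}, 0 < t%:num ->
    (iter m phi t)%:num @[m --> \oo] --> (0 : R).

Definition hutchinson (X : Type) (n : nat) (T : 'I_n -> X -> X)
    (A : set X) : set X :=
  \bigcup_(i in [set: 'I_n]) (T i @` A).

Definition fractal (X : Type) (n : nat) (T : 'I_n -> X -> X) (F : set X) :=
  F !=set0 /\ F = hutchinson T F.

Definition psi (R : realType) (Phi : {nonneg R} -> {nonneg R} -> {nonneg R})
    (phi : {nonneg R} -> {nonneg R}) (t : {nonneg R}) : \bar R :=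
  ereal_sup [set s%:num%:E | s in [set s : {nonneg R} | s <= Phi t (phi s)]].

(* Main.v *)
(* Only boundedness of the sets matters.  Upper semicontinuity of [phi] and
   [Phi] lets the inequalities for points pass to the infimum defining D, so
   D (T A) (T B) <= phi (D A B) and D A B <= Phi (D A C) (D C B).  Hence
   s := D H_k H_0 satisfies s <= Phi (D H_k H_(k+1)) (phi s), which puts it in
   the set whose supremum is psi (D H_k H_(k+1)).  Compactness only serves to
   make these distances finite. *)

Require Import Defs.
From mathcomp Require Import all_boot all_order all_algebra.
From mathcomp Require Import all_classical all_reals all_analysis.

Import Order.TTheory GRing.Theory Num.Theory.
Import numFieldNormedType.Exports.

Local Open Scope classical_set_scope.
Local Open Scope ring_scope.

(** The topology is induced from [R], so [V] contains the trace of a ball around [u]; half its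
    radius makes the segment closed. Only the right half is kept: its points stay nonnegative. *)
Lemma nbhs_nonneg_segment {R : realType} (u : {nonneg R}) (V : set {nonneg R}) :
  nbhs u V -> exists2 e : {nonneg R}, 0 < e%:num &
    forall w : {nonneg R}, u%:num <= w%:num <= u%:num + e%:num -> V w.
Proof.
rewrite nbhsE => -[U [[W oW WU] Uu] UV].
have : nbhs u%:num W by apply: open_nbhs_nbhs; split=> //; move: Uu; rewrite -WU.
move=> /nbhs_ballP[e /= e0 eW].
have e20 : 0 <= e / 2 by rewrite divr_ge0// ltW.
exists (NngNum e20) => /=; first by rewrite divr_gt0.
move=> w /andP[uw we]; apply: UV; rewrite -WU; apply: eW.
rewrite /ball/= distrC ger0_norm ?subr_ge0// ltrBlDl (le_lt_trans we)//.
by rewrite ltrD2l ltr_pdivrMr// ltr_pMr// ltr1n.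
Qed.

(** The strict gap [u < e] is the point: a Hausdorff distance [u] need not be attained, but every
    larger [e] is an admissible radius, and [f e] is still below [a]. *)
Lemma upper_semicontinuous_segment {R : realType} (f : {nonneg R} -> {nonneg R})
    (u : {nonneg R}) (a : R) :
  upper_semicontinuous (fun t => (f t)%:num%:E) -> (f u)%:num < a ->
  exists2 e : {nonneg R}, u%:num < e%:num & (f e)%:num < a.
Proof.
move=> /(_ u a) + fua; rewrite lte_fin => /(_ fua)[V /nbhs_nonneg_segment[e e0 eV] Va].
exists (u%:num + e%:num)%:nng => /=; first by rewrite ltrDl.
by rewrite -lte_fin; apply/Va/eV; rewrite /= lexx lerDl/= andbT.
Qed.

Lemma upper_semicontinuous_segment2 {R : realType}
    (f : {nonneg R} -> {nonneg R} -> {nonneg R}) (u v : {nonneg R}) (a : R) :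
  upper_semicontinuous
    (fun uv : {nonneg R} * {nonneg R} => (f uv.1 uv.2)%:num%:E) ->
  (f u v)%:num < a ->
  exists e1 e2 : {nonneg R},
    [/\ u%:num < e1%:num, v%:num < e2%:num & (f e1 e2)%:num < a].
Proof.
move=> /(_ (u, v) a) + fa; rewrite lte_fin => /(_ fa)[V [[V1 V2] /= [nV1 nV2] sV] Va].
have [e1 e10 eV1] := nbhs_nonneg_segment _ _ nV1.
have [e2 e20 eV2] := nbhs_nonneg_segment _ _ nV2.
exists (u%:num + e1%:num)%:nng, (v%:num + e2%:num)%:nng => /=.
rewrite !ltrDl; split=> //; rewrite -lte_fin.
apply: (Va (_, _)); apply: sV; split => /=; [apply: eV1|apply: eV2];
  by rewrite /= lexx lerDl andbT.
Qed.

Section hausdorff_pompeiu_theory.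
Context {R : realType} {X : pointedType} (d : semimetric R X).
Implicit Types (A B C : set X) (e r : {nonneg R}).

(** Finite radii and weak inequalities, unlike the strict balls behind [hausdorff_pompeiu], pass
    directly through the monotone [phi] and [Phi]. *)
Definition within_distance A B e :=
  (forall a, A a -> exists2 b, B b & d a b <= e) /\
  (forall b, B b -> exists2 a, A a & d a b <= e).

Lemma hausdorff_pompeiu_le A B e :
  within_distance A B e -> (hausdorff_pompeiu d A B <= e%:num%:E)%E.
Proof.
move=> [AB BA]; apply/lee_addgt0Pr => s s0; apply: ereal_inf_lbound; split.
- by rewrite -EFinD lte_fin ltr_wpDl.
- move=> a /AB[b Bb abe]; exists b => //.
  by rewrite /sball/= -EFinD lte_fin (@le_lt_trans _ _ e%:num) ?ltrDl.
- move=> b /BA[a Aa abe]; exists a => //.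
  by rewrite /sball/= sdistC -EFinD lte_fin (@le_lt_trans _ _ e%:num) ?ltrDl.
Qed.

(** Strictness provides an admissible radius below [e]; at equality the infimum may fail to be
    attained. *)
Lemma hausdorff_pompeiu_lt A B e :
  (hausdorff_pompeiu d A B < e%:num%:E)%E -> within_distance A B e.
Proof.
move=> /ereal_inf_lt[s [s0 AB BA] se]; split.
- move=> a /AB[b Bb abs]; exists b => //.
  by rewrite -num_le /= -lee_fin ltW// (lt_trans _ se).
- move=> b /BA[a Aa abs]; exists a => //.
  by rewrite sdistC -num_le /= -lee_fin ltW// (lt_trans _ se).
Qed.

Lemma hausdorff_pompeiu_ge0 A B : (0 <= hausdorff_pompeiu d A B)%E.
Proof. by apply: le_ereal_inf_tmp => e [/ltW]. Qed.

(** The bound is required around every center, so that changing the center costs no appeal to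
    [Phi]. *)
Definition bounded_nonempty A :=
  A !=set0 /\ forall p, exists e, forall a, A a -> d a p <= e.

Lemma hausdorff_pompeiu_fin A B : bounded_nonempty A -> bounded_nonempty B ->
  exists r, hausdorff_pompeiu d A B = r%:num%:E.
Proof.
move=> [[a Aa] bA] [[b Bb] bB].
have [eA AeA] := bA b; have [eB BeB] := bB a.
have : (hausdorff_pompeiu d A B <= (Num.max eA%:num eB%:num)%:nng%:num%:E)%E.
  apply: hausdorff_pompeiu_le; split=> [x Ax|x Bx].
    by exists b => //; rewrite -num_le /= le_max !num_le AeA.
  by exists a => //; rewrite sdistC -num_le /= le_max !num_le BeB ?orbT.
have := hausdorff_pompeiu_ge0 A B.
case: (hausdorff_pompeiu d A B) => [r||]//=.
by rewrite lee_fin => r0 _; exists (NngNum r0).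
Qed.

Section triangle.
Variable Phi : {nonneg R} -> {nonneg R} -> {nonneg R}.
Hypothesis Phi_tri : triangle_function d (fun u v => (Phi u v)%:num%:E).
Hypothesis Phi_usc : upper_semicontinuous
  (fun uv : {nonneg R} * {nonneg R} => (Phi uv.1 uv.2)%:num%:E).

Lemma triangle_le x y z u v : d x z <= u -> d z y <= v -> d x y <= Phi u v.
Proof.
case: Phi_tri => _ _ Phi_mono _ tri xz zy.
by rewrite -num_le -lee_fin (le_trans (tri x y z))// Phi_mono.
Qed.

Lemma hausdorff_pompeiu_triangle A B C r s :
  hausdorff_pompeiu d A C = r%:num%:E -> hausdorff_pompeiu d C B = s%:num%:E ->
  (hausdorff_pompeiu d A B <= (Phi r s)%:num%:E)%E.
Proof.
move=> ACr CBs; apply/lee_addgt0Pr => e e0.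
(* Enlarging [r] and [s] to [e1] and [e2] gives actual intermediate points in [C], at a cost of at
   most [e] in the value of [Phi]. *)
have [|e1 [e2 [re1 se2 Phie]]] :=
  upper_semicontinuous_segment2 _ r s ((Phi r s)%:num + e) Phi_usc.
  by rewrite ltrDl.
have [AC CA] : within_distance A C e1.
  by apply: hausdorff_pompeiu_lt; rewrite ACr lte_fin.
have [CB BC] : within_distance C B e2.
  by apply: hausdorff_pompeiu_lt; rewrite CBs lte_fin.
rewrite (@le_trans _ _ (Phi e1 e2)%:num%:E)//; last by rewrite -EFinD lee_fin ltW.
apply: hausdorff_pompeiu_le; split.
- by move=> a /AC[c /CB[b Bb cb] ac]; exists b => //; exact: (triangle_le _ _ c).
- by move=> b /BC[c /CA[a Aa ac] cb]; exists a => //; exact: (triangle_le _ _ c).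
Qed.

(* Balls need not be open, but upper semicontinuity of [Phi] at the origin
   makes them neighbourhoods of their centers. *)
Lemma sopen_centers A :
  sopen d [set x | exists2 e, 0 < e%:num & forall y, d y x <= e -> A y].
Proof.
move=> p [e e0 eA].
have Phi00 : (Phi 0%:nng 0%:nng)%:num < e%:num.
  by case: Phi_tri => _ _ _ [->].
have [e1 [e2 [/= e10 e20 Phie]]] :=
  upper_semicontinuous_segment2 _ _ _ _ Phi_usc Phi00.
(* [e1] bounds the move from [p] to [x] and [e2] the one from [x] to [y], so [d y p] is at most
   [Phi e2 e1 = Phi e1 e2], which is below [e]. *)
exists e1%:num%:E => //; rewrite /sball => x /=; rewrite lte_fin num_lt => /ltW xp.
exists e2 => // y yx; apply: eA; rewrite -num_le /= (le_trans _ (ltW Phie))//.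
case: Phi_tri => _ PhiC _ _ _; rewrite -lee_fin PhiC lee_fin num_le.
exact: (triangle_le _ _ _ _ _ yx xp).
Qed.

(** The balls around [p] may not be open, so the cover uses the sets that [sopen_centers] extracts
    from the closed ones of integer radius. *)
Lemma compact_nonempty_bounded A : compact_nonempty d A -> bounded_nonempty A.
Proof.
move=> [A0 cA]; split=> // p.
pose U (m : nat) : set (semimetric_topology d) := [set x | exists2 e : {nonneg R},
  0 < e%:num & forall y, d y x <= e -> (d y p)%:num <= m%:R].
have [D _ AD] : finite_subset_cover [set: nat] U A.
  apply: cA => [m _|x Ax]; first exact: sopen_centers.
  (* Every [y] within 1 of [x] has [d y p] at most [Phi 1 (d x p)]; the index is an integer above
     this value. *)
  exists (Num.truncn (Phi 1%:nng (d x p))%:num).+1 => //; exists 1%:nng => //= y yx.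
  rewrite ltW// (le_lt_trans _ (truncnS_gt _))// num_le.
  exact: (triangle_le _ _ _ _ _ yx (lexx _)).
exists ((\max_(m <- finmap.enum_fset D) m)%N%:R)%:nng => a /AD[m /= mD [e e0 /(_ a)]].
rewrite (_ : d a a = 0%:nng); last exact/sdist_eq0.
rewrite -num_le /= => /(_ _)/le_trans; apply => //.
by rewrite ler_nat (@leq_bigmax_seq _ _ xpredT id).
Qed.

Section contraction.
Variables (phi : {nonneg R} -> {nonneg R}) (n : nat) (T : 'I_n -> X -> X).
Hypothesis phi_homo : {homo phi : s t / s <= t}.
Hypothesis T_contr : forall i, phi_contraction d phi (T i).

Lemma hutchinson_bounded A : (0 < n)%N ->
  bounded_nonempty A -> bounded_nonempty (hutchinson T A).
Proof.
move=> n0 [[a Aa] bA]; split.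
  by exists (T (Ordinal n0) a); exists (Ordinal n0) => //; exists a.
move=> p; have [e Ae] := bA a.
exists (\big[Order.max/0%:nng]_i Phi (phi e) (d (T i a) p)).
move=> _ [i _ [x Ax <-]].
rewrite (le_trans _ (le_bigmax _ _ i))//.
apply: (triangle_le _ _ (T i a)) => //.
by rewrite (le_trans (T_contr _ _ _))// phi_homo// Ae.
Qed.

Hypothesis phi_usc : upper_semicontinuous (fun t => (phi t)%:num%:E).

(** A point [T i a] is matched with [T i b] for the same [i], where [b] is close to [a]. *)
Lemma hausdorff_pompeiu_hutchinson A B r :
  hausdorff_pompeiu d A B = r%:num%:E ->
  (hausdorff_pompeiu d (hutchinson T A) (hutchinson T B) <= (phi r)%:num%:E)%E.
Proof.
move=> ABr; apply/lee_addgt0Pr => s s0.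
have [|e re phie] := upper_semicontinuous_segment _ r ((phi r)%:num + s) phi_usc.
  by rewrite ltrDl.
have [AB BA] : within_distance A B e.
  by apply: hausdorff_pompeiu_lt; rewrite ABr lte_fin.
rewrite (@le_trans _ _ (phi e)%:num%:E)//; last by rewrite -EFinD lee_fin ltW.
apply: hausdorff_pompeiu_le; split.
- move=> _ [i _ [a /AB[b Bb ab] <-]]; exists (T i b); first by exists i => //; exists b.
  by rewrite (le_trans (T_contr _ _ _))// phi_homo.
- move=> _ [i _ [b /BA[a Aa ab] <-]]; exists (T i a); first by exists i => //; exists a.
  by rewrite (le_trans (T_contr _ _ _))// phi_homo.
Qed.

End contraction.

End triangle.

End hausdorff_pompeiu_theory.

Theorem theorem15 (R : realType) (X : pointedType) (d : semimetric R X)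
    (Phi : {nonneg R} -> {nonneg R} -> {nonneg R})
    (phi : {nonneg R} -> {nonneg R})
    (n : nat) (T : 'I_n -> X -> X)
    (H H0 : set X) (H_ : nat -> set X) :
  scomplete d ->
  regular_semimetric d ->
  triangle_function d (fun u v => (Phi u v)%:num%:E) ->
  upper_semicontinuous
    (fun uv : {nonneg R} * {nonneg R} => (Phi uv.1 uv.2)%:num%:E) ->
  comparison_function phi ->
  upper_semicontinuous (fun t : {nonneg R} => (phi t)%:num%:E) ->
  (0 < n)%N ->
  (forall i, phi_contraction d phi (T i)) ->
  compact_nonempty d H ->
  compact_nonempty d H0 ->
  fractal T H0 ->
  H_ 1%N = H ->
  (forall k : nat, (1 <= k)%N -> H_ k.+1 = hutchinson T (H_ k)) ->
  (forall k l : nat, (1 <= l <= k)%N ->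
    exists2 r : {nonneg R},
      hausdorff_pompeiu d (H_ l) (H_ l.+1) = r%:num%:E &
      (hausdorff_pompeiu d (H_ k) H0 <= psi Phi phi (iter (k - l) phi r))%E) /\
  (forall k : nat, (2 <= k)%N ->
    exists2 r : {nonneg R},
      hausdorff_pompeiu d (H_ k.-1) H0 = r%:num%:E &
      (hausdorff_pompeiu d (H_ k) H0 <= (phi r)%:num%:E)%E).

Proof.
move=> _ _ Phi_tri Phi_usc [phi_homo _] phi_usc n0 T_contr cH cH0 [_ fH0] H1 HS.
have bH0 := compact_nonempty_bounded _ _ Phi_tri Phi_usc _ cH0.
(* Indices are shifted because the sequence starts at 1: [H_ 0] is arbitrary and is not the fractal
   [H0]. *)
have bH k : bounded_nonempty d (H_ k.+1).
  elim: k => [|k IH].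
    by rewrite H1; exact: (compact_nonempty_bounded _ _ Phi_tri Phi_usc _ cH).
  by rewrite HS//; exact: (hutchinson_bounded _ _ Phi_tri phi).
have contr A B r (ABr : hausdorff_pompeiu d A B = r%:num%:E) :=
  hausdorff_pompeiu_hutchinson _ _ _ _ phi_homo T_contr phi_usc A B r ABr.
have contrH0 k r : hausdorff_pompeiu d (H_ k.+1) H0 = r%:num%:E ->
    (hausdorff_pompeiu d (H_ k.+2) H0 <= (phi r)%:num%:E)%E.
  by move=> Dr; rewrite HS// fH0; exact: contr.
split; last first.
  move=> [|[|k]]//= _; have [r Dr] := hausdorff_pompeiu_fin _ _ _ (bH k) bH0.
  by exists r => //; exact: contrH0.
move=> k [|l]// /andP[_ lk].
have [r Dr] := hausdorff_pompeiu_fin _ _ _ (bH l) (bH l.+1).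
(* The set [H_ k] becomes [H_ (l + m).+1], with [m] the number of iterations of [phi]. *)
exists r => //; rewrite -{1}(subnKC lk) addSn; set m := (k - l.+1)%N.
have [s Ds] := hausdorff_pompeiu_fin _ _ _ (bH (l + m)%N) bH0.
have [s' Ds'] := hausdorff_pompeiu_fin _ _ _ (bH (l + m).+1) bH0.
have [t Dt] := hausdorff_pompeiu_fin _ _ _ (bH (l + m)%N) (bH (l + m).+1).
(* Applying the Hutchinson map [m] times to the initial pair contracts its distance [r] by [phi] at
   each stage. *)
have tr : t <= iter m phi r.
  elim: m {s s' Ds Ds'} t Dt => [|m IH] t.
    by rewrite addn0 Dr => -[rt]; rewrite -num_le rt.
  rewrite addnS HS// [X in hausdorff_pompeiu _ _ X]HS// => Dt.
  have [t' Dt'] := hausdorff_pompeiu_fin _ _ _ (bH (l + m)%N) (bH (l + m).+1).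
  rewrite (@le_trans _ _ (phi t'))//; last by rewrite phi_homo// IH.
  by rewrite -num_le -lee_fin -Dt; exact: contr.
have s's : s' <= phi s by rewrite -num_le -lee_fin -Ds'; exact: contrH0.
(* The triangle inequality through the next iterate gives [s <= Phi t s']; monotonicity of [Phi]
   with [tr] and [s's] then puts [s] in the set defining [psi] at [iter m phi r]. *)
rewrite Ds; apply: ereal_sup_ubound; exists s => //=.
rewrite -num_le -lee_fin -Ds.
rewrite (le_trans (hausdorff_pompeiu_triangle _ _ Phi_tri Phi_usc _ _ _ _ _ Dt Ds'))//.
by case: Phi_tri => _ _ + _ _; apply.
Qed.
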